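(* Let $R$ be a commutative ring and let $n\ge 1$ be an integer. Suppose that every matrix in $\mathbb{M}_n(R)$ is a sum of three idempotents of $\mathbb{M}_n(R)$. Then $J(R)$ is nil and $R/J(R)$ satisfies the identity $x^3=x$. If in addition $R$ is an indecomposable ring, then $R\cong \mathbb{Z}_k$ for some $k\in\{2,3,4\}$.
   Context: Rings are associative with $1$. $\mathbb{M}_n(R)$ is the ring of $n\times n$ matrices over $R$. An element $a$ of a ring is an idempotent if $a^2=a$. $J(R)$ is the Jacobson radical of $R$; it is nil if all its elements are nilpotent. A ring satisfies the identity $x^3=x$ if $x^3=x$ for every element $x$. A ring is indecomposable if it is nonzero and is not isomorphic to a direct product of two nonzero rings. $\mathbb{Z}_k$ denotes the ring of integers modulo $k$. *)

(* Defs.v *)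
From HB Require Import structures.
From mathcomp Require Import all_boot all_order all_algebra.
From mathcomp Require Import boolp classical_sets.
Set Implicit Arguments.
Unset Strict Implicit.
Unset Printing Implicit Defensive.
Import GRing.Theory.
Local Open Scope ring_scope.
Local Open Scope quotient_scope.

(* Rings are pzRingType, so that the zero ring is not excluded. *)

Definition idempotent_elt (S : pzRingType) (a : S) : Prop := a ^+ 2 = a.

Definition nilpotent_elt (S : pzRingType) (a : S) : Prop :=
  exists m : nat, a ^+ m.+1 = 0.

Definition cube_identity (S : pzRingType) : Prop := forall x : S, x ^+ 3 = x.

Definition ring_isomorphic (S T : pzRingType) : Prop :=
  exists f : {rmorphism S -> T}, bijective f.

Definition indecomposable_ring (S : pzRingType) : Prop :=
  (1 : S) <> 0 /\
  ~ exists A B : nzRingType, ring_isomorphic S (A * B)%type.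

Definition left_ideal (S : pzRingType) (I : set S) : Prop :=
  [/\ I 0, forall x y, I x -> I y -> I (x + y) & forall a x, I x -> I (a * x)].

Definition maximal_left_ideal (S : pzRingType) (M : set S) : Prop :=
  [/\ left_ideal M, ~ M 1 &
      forall I : set S, left_ideal I -> ~ I 1 ->
        (M `<=` I)%classic -> (I `<=` M)%classic].

(* Boolean-valued (classically), since the quotient library requires decidable
   predicates.  In the zero ring there is no maximal left ideal, and J = S. *)
Definition jacobson (S : pzRingType) : {pred S} :=
  fun x => `[< forall M : set S, maximal_left_ideal M -> M x >].
Arguments jacobson : clear implicits.

Definition nil_jacobson (S : pzRingType) : Prop :=
  forall x : S, x \in jacobson S -> nilpotent_elt x.

Lemma in_jacobson (S : pzRingType) (x : S) :
  x \in jacobson S <-> forall M : set S, maximal_left_ideal M -> M x.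
Proof. by rewrite unfold_in; split => /asboolP. Qed.

Lemma jacobson_zmod_closed (S : pzRingType) : zmod_closed (jacobson S).
Proof.
split=> [|x y /in_jacobson Jx /in_jacobson Jy]; apply/in_jacobson => M mM.
  by case: (mM) => -[M0 _ _].
case: (mM) => -[_ MD MM] _ _; apply: MD; first exact: Jx.
by rewrite -mulN1r; apply: MM; apply: Jy.
Qed.

HB.instance Definition _ (S : pzRingType) :=
  GRing.isZmodClosed.Build S (jacobson S) (@jacobson_zmod_closed S).

Lemma jacobsonMl (S : pzRingType) (a x : S) :
  x \in jacobson S -> a * x \in jacobson S.
Proof.
move=> /in_jacobson Jx; apply/in_jacobson => M mM.
by case: (mM) => -[_ _ MM] _ _; apply: MM; apply: Jx.
Qed.

(* The library puts a ring structure on Quotient.quot I only for proper ideals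
   I of nonzero rings; here R may be the zero ring. *)
Section JacobsonQuotient.
Variable R : comPzRingType.

Definition jacobson_quot : Type := Quotient.quot (jacobson R).

HB.instance Definition _ := GRing.Zmodule.on jacobson_quot.
HB.instance Definition _ := EqQuotient.on jacobson_quot.

Local Notation Q := jacobson_quot.

Definition jquot_one : Q := \pi_Q 1.
Definition jquot_mul (x y : Q) : Q := \pi_Q (repr x * repr y).

Lemma jquot_eqE (x y : R) : (\pi_Q x == \pi_Q y) = (x - y \in jacobson R).
Proof. by rewrite (@Quotient.idealrBE R (jacobson R)). Qed.

Lemma jquot_piD : {morph \pi_Q : x y / x + y}.
Proof. exact: (@Quotient.pi_add R (jacobson R)). Qed.

Lemma jquot_piM (x y : R) : \pi_Q (x * y) = jquot_mul (\pi_Q x) (\pi_Q y).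
Proof.
apply/eqP; rewrite jquot_eqE.
set x' := repr _; set y' := repr _.
have Jx : x - x' \in jacobson R by rewrite -jquot_eqE reprK.
have Jy : y - y' \in jacobson R by rewrite -jquot_eqE reprK.
have -> : x * y - x' * y' = y * (x - x') + x' * (y - y').
  by rewrite !mulrBr [y * x]mulrC [y * x']mulrC addrA subrK.
by apply: rpredD; exact: jacobsonMl.
Qed.

Lemma jquot_mulA : associative jquot_mul.
Proof.
move=> x y z; rewrite -[x]reprK -[y]reprK -[z]reprK.
move: (repr x) (repr y) (repr z) => a b c.
by rewrite -(jquot_piM b c) -(jquot_piM a b) -(jquot_piM a) -jquot_piM mulrA.
Qed.

Lemma jquot_mulC : commutative jquot_mul.
Proof. by move=> x y; rewrite -[x]reprK -[y]reprK -!jquot_piM mulrC. Qed.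

Lemma jquot_mul1 : left_id jquot_one jquot_mul.
Proof. by move=> x; rewrite -[x]reprK -jquot_piM mul1r. Qed.

Lemma jquot_mulDl : left_distributive jquot_mul +%R.
Proof.
move=> x y z; rewrite -[x]reprK -[y]reprK -[z]reprK.
by rewrite -jquot_piD -!jquot_piM -jquot_piD mulrDl.
Qed.

HB.instance Definition _ := GRing.Zmodule_isComPzRing.Build jacobson_quot
  jquot_mulA jquot_mulC jquot_mul1 jquot_mulDl.

End JacobsonQuotient.

(* Main.v *)
(* Let E1 + E2 + E3 = 4 with E_i idempotent and D = E2 - E3.  Then E1 D + D E1 = 6 D
   and D^2 = 5 E1 - 8, which force 60 E1 = 0; hence 240 = 0 in R.

   The trace of an idempotent matrix E over a commutative ring is a sum of integer
   multiples of orthogonal idempotents with sum 1: f(X) = det (1 - E + X E) satisfies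
   f(X) f(Y) = f(XY) and f'(1) = tr E.  Since every x in R is the trace of a sum of three
   idempotents, x is an integer modulo every prime ideal, and x is an integer in R if R
   is connected.

   Residue characteristic 5 is excluded as follows.  Writing 4 as a sum of three
   idempotents over F_5 forces n to be even.  Writing 4 + 3 E_00 = G1 + G2 + G3
   gives involutions a, b, c = 2 G_i - 1 with a + b + c = E_00.  Here a - b anticommutes with a + b,
   which constrains the (0, 0) entries: either all three are 2, and then a - b is
   invertible so that the traces contradict tr a + tr b + tr c = 1, or one is 1, and
   then comparing det (2 - (a + b)) with det (2 + (a + b)) shows that n is odd.

   Hence 5 is a unit and 48 = 0.  So 6 lies in every prime ideal, and x^3 - x too.  If R
   is connected it is a quotient of Z/48, hence of Z/16 or Z/3; in the first case
   4 E_i = 0, so the entries of E_i are even unless 4 = 0, and an even idempotent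
   killed by 4 vanishes. *)
Require Import Defs.
From HB Require Import structures.
From mathcomp Require Import all_boot all_order fingroup perm all_algebra.
From mathcomp Require Import boolp classical_sets.
From mathcomp Require Import ring.
Set Implicit Arguments.
Unset Strict Implicit.
Unset Printing Implicit Defensive.
Import GRing.Theory.
Local Open Scope ring_scope.

(* Treats products of matrices as atoms: what remains is checked entrywise, in the
   commutative ring of coefficients. *)
Ltac mxlin :=
  repeat (let X := fresh "X" in set X := (_ * _); clearbody X);
  try (let X := fresh "X" in set X := 1; clearbody X);
  apply/matrixP => ? ?; rewrite !mxE; ring.
Ltac mxexp := rewrite ?(mulrDl, mulrDr, mulNr, mulrN, mulrnAl, mulrnAr, mul1r, mulr1).

(** * Three idempotents with sum 4 *)

(** Expanding [E * E = E] with [E = 4 - P - Q] gives [Q P = 6 (P + Q) - P Q - 12], which reduces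
    every product to a combination of [1], [P], [Q] and [P Q]. *)
Lemma scalar4_idempotent (R : comPzRingType) n (E P Q : 'M[R]_n) :
    E * E = E -> P * P = P -> Q * Q = Q -> E + P + Q = 4%:R ->
  let D := P - Q in
  E * D + D * E = D *+ 6 /\ D * D = E *+ 5 - 8%:R.
Proof.
move=> EE PP QQ eq4 D.
have defE : E = 4%:R - Q - P by rewrite -eq4 !addrK.
have QP : Q * P = (P + Q) *+ 6 - P * Q - 12%:R.
  move: EE; rewrite defE; mxexp; rewrite PP QQ => EE.
  apply/eqP; rewrite -subr_eq0; move/eqP: EE; rewrite -subr_eq0 => /eqP <-.
  by apply/eqP; mxlin.
split; rewrite /D defE; mxexp; rewrite ?PP ?QQ ?QP; mxlin.
Qed.

(** Multiplying [E D + D E = 6 D] by [E] on the left gives [E D E = 5 E D], and on both sides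
    [4 E D E = 0]. Hence [20 E D = 0], and a further factor [D] on the right gives
    [20 (5 E - 8 E) = 0]. *)
Lemma mul60_idempotent (R : comPzRingType) n (E P Q : 'M[R]_n) :
    E * E = E -> P * P = P -> Q * Q = Q -> E + P + Q = 4%:R -> E *+ 60 = 0.
Proof.
move=> EE PP QQ eq4; have [] := scalar4_idempotent EE PP QQ eq4.
set D := P - Q => EDDE DD.
have ED5 : E * D * E = E * D *+ 5.
  have := congr1 ( *%R E) EDDE; rewrite mulrDr !mulrA EE mulrnAr => /(canRL (addKr _)) ->.
  by rewrite mulrSr addrCA addNr addr0.
have EDE4 : E * D * E *+ 4 = 0.
  have := congr1 (fun X => E * X * E) EDDE.
  rewrite mulrDr mulrDl !mulrA EE -!mulrA EE !mulrA mulrnAr mulrnAl => H.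
  by apply: (addrI (E * D * E + E * D * E)); rewrite addr0 [RHS]H -mulr2n -mulrnDr.
have ED20 : E * D *+ 20 = 0 by rewrite -[20%N]/(5 * 4)%N mulrnA -ED5.
have := congr1 ( *%R^~ D) ED20; rewrite mul0r mulrnAl -mulrA DD => E3.
have E8 : E *+ 5 - E *+ 8 = - (E *+ 3) by mxlin.
by apply: oppr_inj; rewrite oppr0 -{}E3 mulrBr mulr_natr mulrnAr EE E8 mulNrn -mulrnA.
Qed.

(** * Traces of idempotent matrices *)

Lemma coef_prod_lin (R : comNzRingType) (I : Type) (r : seq I) (c a : I -> R) :
  (\prod_(i <- r) ((c i)%:P + 'X * (a i)%:P))`_0 = \prod_(i <- r) c i.
Proof.
elim: r => [|i r IH]; first by rewrite !big_nil coef1.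
by rewrite !big_cons coefM big_ord1 IH coefD coefC coefXM addr0.
Qed.

(** A permutation [s] other than the identity moves some [i] and also [s i], so its Leibniz term is
    divisible by the square of the variable. *)
Lemma det_1DX_coef1 (R : comNzRingType) n (A : 'M[R]_n) :
  (\det (1%:M + 'X *: map_mx polyC A))`_1 = \tr A.
Proof.
rewrite /determinant coef_sum (bigD1 (1%g : {perm 'I_n})) //=.
rewrite [X in _ + X]big1 ?addr0; last first.
  move=> s s1.
  have [i si] : exists i, s i != i.
    apply/existsP; apply: contra_neqT s1; rewrite negb_exists => /forallP s1.
    by apply/permP => i; rewrite perm1; apply/eqP; rewrite -[_ == _]negbK.
  have sisi : s (s i) != s i by rewrite (inj_eq perm_inj).
  rewrite -signr_odd (bigD1 i) //= (bigD1 (s i)) //= !mxE.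
  rewrite eq_sym (negPf si) eq_sym (negPf sisi) !mulr0n !add0r.
  set q := \prod_(_ | _) _.
  have regroup (c x a b p : {poly R}) :
    c * (x * a * (x * b * p)) = x * (x * (c * (a * (b * p)))) by ring.
  by rewrite regroup coefXM /= coefXM.
rewrite odd_perm1 expr0 mul1r /mxtrace.
rewrite (eq_bigr (fun i => 1%:P + 'X * (A i i)%:P)); last first.
  by move=> i _; rewrite perm1 !mxE eqxx.
elim: (index_enum _) => [|i r IH]; first by rewrite !big_nil coef1.
rewrite !big_cons -IH mulrDl mul1r coefD addrC; congr (_ + _).
rewrite -mulrA coefXM /= mulrC coefMC.
by rewrite (coef_prod_lin r (fun=> 1)) big1_eq mul1r.
Qed.

Lemma horner_map_det (R S : comNzRingType) (phi : {rmorphism R -> S}) n (E : 'M[R]_n) (a : S) :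
  (map_poly phi (\det (1%:M + ('X - 1) *: map_mx polyC E))).[a]
    = \det (1%:M + (a - 1) *: map_mx phi E).
Proof.
have ca : commr_rmorph phi a by move=> x; apply: mulrC.
rewrite -[LHS]/(horner_morph ca _) -det_map_mx; congr (\det _).
apply/matrixP => i j.
by rewrite !mxE rmorphD rmorphM rmorphB rmorphMn rmorph1 /= horner_morphX horner_morphC.
Qed.

(** Multiplicativity of [f] is the determinant of [(1 + (a - 1) E) (1 + (b - 1) E) = 1 + (a b - 1)
    E]. *)
Lemma idempotent_trace (R : comNzRingType) n (E : 'M[R]_n) : E *m E = E ->
  exists f : {poly R},
    [/\ forall i j, f`_i * f`_j = if i == j then f`_i else 0, f.[1] = 1
      & f^`().[1] = \tr E].
Proof.
move=> EE; pose f : {poly R} := \det (1%:M + ('X - 1) *: map_mx polyC E).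
exists f; split.
(* Compare the coefficients of f(Y) f(X) = f(XY) in R[X][Y]. *)
- pose phi : {rmorphism R -> {poly {poly R}}} := polyC \o polyC.
  pose F a := (map_poly phi f).[a].
  have FM a b : F a * F b = F (a * b).
    rewrite /F !horner_map_det -det_mulmx; congr (\det _).
    set G := map_mx _ E; have GG : G *m G = G by rewrite -map_mxM EE.
    rewrite mulmxDl !mulmxDr !mul1mx mulmx1 -scalemxAl -scalemxAr GG.
    by apply/matrixP => i j; rewrite !mxE; ring.
  have FE a : F a = \sum_(i < size f) (f`_i)%:P%:P * a ^+ i.
    rewrite /F (@horner_coef_wide _ (size f)) ?size_poly //.
    by apply: eq_bigr => i _; rewrite coef_map.
  (* X is the inner variable ['X%:P] and Y the outer variable ['X]. *)
  have FX : F 'X%:P = f%:P.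
    rewrite FE -[f in RHS]coefK poly_def rmorph_sum; apply: eq_bigr => i _.
    by rewrite -mul_polyC rmorphM rmorphXn.
  have FY : F 'X = \poly_(i < size f) (f`_i)%:P.
    by rewrite FE poly_def; apply: eq_bigr => i _; rewrite mul_polyC.
  have FXY : F ('X%:P * 'X) = \poly_(i < size f) (f`_i *: 'X^i).
    rewrite FE poly_def; apply: eq_bigr => i _.
    by rewrite exprMn mulrA -rmorphXn -rmorphM /= !mul_polyC.
  move=> i j; have := FM 'X%:P 'X; rewrite FX FY FXY.
  move=> /(congr1 (fun p : {poly {poly R}} => p`_j)).
  rewrite coefCM !coef_poly; case: ltnP => [_|le_j]; last first.
    by move=> _; rewrite (nth_default 0 le_j) mulr0; case: eqP => // ->; rewrite nth_default.
  move=> /(congr1 (fun p : {poly R} => p`_i)); rewrite coefMC coefZ coefXn => ->.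
  by case: eqP => [->|_]; rewrite ?mulr1 ?mulr0.
- have := horner_map_det idfun E 1; rewrite map_poly_id // => ->.
  by rewrite subrr scale0r addr0 det1.
(* Since [f] is [g] taken at [X - 1], the value of its derivative at 1 is the linear coefficient of
   [g]. *)
pose g : {poly R} := \det (1%:M + 'X *: map_mx polyC E).
have -> : f = g \Po ('X - 1).
  rewrite -det_map_mx; congr (\det _); apply/matrixP => i j.
  by rewrite !mxE rmorphD rmorphM /= rmorphMn rmorph1 /= comp_polyX comp_polyC.
rewrite deriv_comp derivB derivX derivC subr0 mulr1 horner_comp !hornerE subrr.
by rewrite horner_coef0 coef_deriv det_1DX_coef1.
Qed.

(** * Ideals avoiding the powers of an element *)

Lemma left_ideal_sub (R : pzRingType) (I : set R) (x y : R) :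
  left_ideal I -> I x -> I y -> I (x - y).
Proof. by case=> _ ID IM Ix Iy; apply: ID => //; rewrite -mulN1r; apply: IM. Qed.

Lemma left_ideal_sum (R : pzRingType) (I : set R) (J : Type) (r : seq J) (P : pred J)
    (F : J -> R) :
  left_ideal I -> (forall j, P j -> I (F j)) -> I (\sum_(j <- r | P j) F j).
Proof. by case=> I0 ID _ IF; apply: big_ind. Qed.

(** Used twice: [y = 1] gives maximal ideals, and a non-nilpotent [y] gives a prime ideal that
    misses it. *)
Lemma exists_ideal_avoiding_powers (R : pzRingType) (y : R) (I0 : set R) :
    left_ideal I0 -> (forall k, ~ I0 (y ^+ k)) ->
  exists P : set R, [/\ I0 `<=` P, left_ideal P, forall k, ~ P (y ^+ k)
    & forall I, left_ideal I -> (forall k, ~ I (y ^+ k)) -> P `<=` I -> I `<=` P]%classic.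
Proof.
move=> I0i I0y.
pose good (A : set R) := [/\ I0 `<=` A, left_ideal A & forall k, ~ A (y ^+ k)]%classic.
have good0 : good I0 by split.
have [F sF totF | P [[P0|goodP] maxP]] := @Zorn_bigcup R (fun A => A = set0 \/ good A)%classic.
(* Zorn_bigcup also asks for a bound of the empty chain, hence the alternative set0. *)
- have [[A [FA gA]]|nogood] := pselect (exists A, F A /\ good A).
    right; have [sA Ai _] := gA; split.
    + by move=> x /sA Ax; exists A.
    + split; first by exists A => //; case: Ai.
        move=> a b [X FX Xa] [Y FY Yb].
        have goodF Z z : F Z -> Z z -> left_ideal Z.
          by move=> /sF[-> //|[]].
        by have [XY|YX] := totF _ _ FX FY;
          [exists Y => //; have [_ ZD _] := goodF _ _ FY Yb; apply: ZD => //; apply: XY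
          |exists X => //; have [_ ZD _] := goodF _ _ FX Xa; apply: ZD => //; apply: YX].
      move=> a b [X FX Xb]; exists X => //.
      by move: Xb; have [-> //|[_ [_ _ XM] _]] := sF _ FX; apply: XM.
    + by move=> k [X FX]; have [-> //|[_ _]] := sF _ FX; apply.
  left; apply/seteqP; split=> // x [X FX Xx]; case: nogood; exists X; split=> //.
  by move: Xx; have [-> //|] := sF _ FX.
- case: (maxP I0); last by right.
  by rewrite P0; split=> // /(_ 0); case: I0i => h _ _; apply.
have [sP Pi Py] := goodP; exists P; split=> // I Ii Iy sPI.
apply: contrapT => nIP; apply: (maxP I); last first.
  by right; split=> //; apply: (subset_trans sP sPI).
by split.
Qed.

(** If [c] is not in [P], maximality puts a power of [y] in [P + R c]. Two such powers, for [a] and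
    for [b], multiply to a power of [y] in [P + R a b]. *)
Lemma ideal_avoiding_powers_prime (R : comPzRingType) (y : R) (P : set R) :
    left_ideal P -> (forall k, ~ P (y ^+ k)) ->
    (forall I, left_ideal I -> (forall k, ~ I (y ^+ k)) -> P `<=` I -> I `<=` P)%classic ->
  forall a b, P (a * b) -> P a \/ P b.
Proof.
move=> Pi Py maxP a b Pab; have [P0 PD PM] := Pi.
have ext c : ~ P c -> exists k r, P (y ^+ k - r * c).
  move=> nPc; apply: contrapT => no; apply: nPc.
  pose I : set R := [set x | exists r, P (x - r * c)]%classic.
  apply: (maxP I).
  - split; first by exists 0; rewrite mul0r subr0.
      move=> u v [r ru] [s sv]; exists (r + s).
      by have := PD _ _ ru sv; congr (P _); ring.
    move=> u v [r rv]; exists (u * r).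
    by have := PM u _ rv; congr (P _); ring.
  - by move=> k [r Ir]; apply: no; exists k, r.
  - by move=> x Px; exists 0; rewrite mul0r subr0.
  - by exists 1; rewrite mul1r subrr.
have [Pa|/ext[k [r ka]]] := pselect (P a); first by left.
have [Pb|/ext[l [s lb]]] := pselect (P b); first by right.
case: (Py (k + l)%N).
have -> : y ^+ (k + l) =
    y ^+ l * (y ^+ k - r * a) + (r * a) * (y ^+ l - s * b) + (r * s) * (a * b).
  by rewrite exprD; ring.
by apply: (PD _ _ (PD _ _ (PM _ _ ka) (PM _ _ lb)) (PM _ _ Pab)).
Qed.

Lemma maximal_left_idealP (R : comPzRingType) (P : set R) :
  maximal_left_ideal P <-> [/\ left_ideal P, forall k, ~ P (1 ^+ k)
    & forall I, left_ideal I -> (forall k, ~ I (1 ^+ k)) -> P `<=` I -> I `<=` P]%classic.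
Proof.
split=> -[Pi P1 maxP]; split=> //.
- by move=> k; rewrite expr1n.
- by move=> I Ii I1; apply: maxP => //; have := I1 0%N.
- exact: (P1 0%N).
- by move=> I Ii I1; apply: maxP => // k; rewrite expr1n.
Qed.

(** If [a] is not invertible, the principal ideal [R a] avoids 1 and extends to a maximal one. *)
Lemma unit_or_maximal (R : comPzRingType) (a : R) :
  (exists b, b * a = 1) \/ exists2 M : set R, maximal_left_ideal M & M a.
Proof.
have [?|nu] := pselect (exists b, b * a = 1); [by left | right].
pose I : set R := [set x | exists b, x = b * a]%classic.
have [||M [sM Mi M1 maxM]] := @exists_ideal_avoiding_powers R 1 I.
- split; first by exists 0; rewrite mul0r.
    by move=> _ _ [b ->] [c ->]; exists (b + c); rewrite mulrDl.
  by move=> c _ [b ->]; exists (c * b); rewrite mulrA.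
- by move=> k; rewrite expr1n => -[b eb]; apply: nu; exists b.
exists M; first exact/maximal_left_idealP.
by apply: sM; exists 1; rewrite mul1r.
Qed.

(** * Characteristic 5 *)

Section CharFive.
Variables (F : fieldType) (char5 : 5%:R = 0 :> F).

Let neq0_2 : 2%:R != 0 :> F.
Proof.
apply/eqP => F2; have : 1 = 5%:R - 2%:R * 2%:R :> F by ring.
by rewrite char5 F2 mulr0 subrr => /eqP; rewrite oner_eq0.
Qed.

Let neq0_3 : 3%:R != 0 :> F.
Proof.
apply/eqP => F3; have : 1 = 3%:R * 2%:R - 5%:R :> F by ring.
by rewrite char5 F3 mul0r subrr => /eqP; rewrite oner_eq0.
Qed.

Let mulr5n (n : nat) (X : 'M[F]_n) : X *+ 5 = 0.
Proof. by apply/matrixP => i j; rewrite !mxE -[RHS](mulr0 (X i j)) -char5; ring. Qed.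

Lemma involution_det_neq0 n (s : 'M[F]_n) : s * s = 1 -> \det s != 0.
Proof.
move=> /(congr1 determinant) /eqP; rewrite det_mulmx det1.
by apply: contraTneq => ->; rewrite mulr0 eq_sym oner_eq0.
Qed.

(** In characteristic 5 the relations read [E D + D E = D] and [D * D = 2]. So [D] is invertible and
    anticommutes with the involution [1 - 2 E]; determinants give [(-1)^n = 1]. *)
Lemma sum3_scalar4_even n (E P Q : 'M[F]_n) :
    E * E = E -> P * P = P -> Q * Q = Q -> E + P + Q = 4%:R -> ~~ odd n.
Proof.
move=> EE PP QQ eq4; have [] := scalar4_idempotent EE PP QQ eq4.
move: (P - Q) => D EDDE DD.
pose s := 1 - E *+ 2.
have ss : s * s = 1.
  by rewrite /s; mxexp; rewrite EE; mxlin.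
have Ds : D * s = - (s * D).
  rewrite /s; mxexp; apply/eqP; rewrite -subr_eq0; apply/eqP.
  transitivity (D *+ 2 - (E * D + D * E) *+ 2); first by mxlin.
  rewrite EDDE (_ : _ - _ = - (D *+ 5 *+ 2)); last by mxlin.
  by rewrite mulr5n mul0rn oppr0.
have detD : \det D != 0.
  have : \det (D * D) != 0.
    have -> : D * D = 2%:R *: (1 : 'M[F]_n).
      rewrite DD mulr5n sub0r scaler_nat -[RHS]subr0 -[0 in RHS](mul0rn _ 2) -(mulr5n 1).
      by mxlin.
    by rewrite detZ det1 mulr1 expf_neq0.
  by rewrite det_mulmx; apply: contraNneq => ->; rewrite mul0r.
have := congr1 determinant Ds; rewrite -scaleN1r detZ !det_mulmx mulrC => /eqP.
rewrite -[X in X == _]mul1r -subr_eq0 -mulrBl mulf_eq0 mulf_eq0 (negPf detD).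
rewrite (negPf (involution_det_neq0 ss)) /= orbF subr_eq0 -signr_odd.
case: (odd n) => //; rewrite expr1 -subr_eq0 opprK => /eqP F2.
by have := neq0_2; rewrite -[2%:R]/(1 + 1) F2 eqxx.
Qed.

(** * Three involutions whose sum is the matrix unit [P] *)

Variable m : nat.
Let P : 'M[F]_m.+1 := delta_mx 0 0.

Let mulPE (A : 'M[F]_m.+1) i j : (P * A) i j = (i == 0)%:R * A 0 j.
Proof.
rewrite mxE (bigD1 0) //= big1 ?addr0 => [|k /negPf k0]; rewrite !mxE ?k0 ?andbF ?mul0r //.
by rewrite andbT.
Qed.

Let mulAPE (A : 'M[F]_m.+1) i j : (A * P) i j = A i 0 * (j == 0)%:R.
Proof.
rewrite mxE (bigD1 0) //= big1 ?addr0 => [|k /negPf k0]; rewrite !mxE ?k0 ?mulr0 //.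
Qed.

Let PP : P * P = P.
Proof.
by apply/matrixP => i j; rewrite mulPE !mxE eqxx /=; case: eqP; rewrite ?mul1r ?mul0r.
Qed.

Let PAP (A : 'M[F]_m.+1) : P * (A * P) = A 0 0 *: P.
Proof.
apply/matrixP => i j; rewrite mulPE mulAPE !mxE.
by case: (i == 0); case: (j == 0) => /=; ring.
Qed.

Let mulAPB00 (A B : 'M[F]_m.+1) : (A * P * B) 0 0 = A 0 0 * B 0 0.
Proof.
rewrite mxE (bigD1 0) //= big1 ?addr0 => [|k /negPf k0]; rewrite mulAPE ?eqxx ?mulr1 //.
by rewrite k0 mulr0 mul0r.
Qed.

Let add00 (A B : 'M[F]_m.+1) : (A + B) 0 0 = A 0 0 + B 0 0.
Proof. by rewrite mxE. Qed.

Let opp00 (A : 'M[F]_m.+1) : (- A) 0 0 = - A 0 0.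
Proof. by rewrite mxE. Qed.

Let one00 : (1 : 'M[F]_m.+1) 0 0 = 1.
Proof. by rewrite mxE. Qed.

Let P00 : P 0 0 = 1.
Proof. by rewrite mxE. Qed.

Lemma involutions_anticommutator (a b c : 'M[F]_m.+1) :
    a * a = 1 -> b * b = 1 -> c * c = 1 -> a + b + c = P ->
  a * b + b * a = P - P * c - c * P - 1.
Proof.
move=> aa bb cc abc.
have : (a + b) * (a + b) = (P - c) * (P - c) by rewrite -abc addrK.
mxexp; rewrite aa bb cc PP => h.
transitivity (1 + a * b + (b * a + 1) - 1 - 1); first by mxlin.
by rewrite h; mxlin.
Qed.

(** Conjugation by [a] fixes [a b + b a]; both sides are compared at (0, 0). The unknown corners of
    [c a] and [a c] occur only through their sum, which the anticommutator of [a] and [c]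
    determines. *)
Lemma involutions_corner_rel (a b c : 'M[F]_m.+1) :
    a * a = 1 -> b * b = 1 -> c * c = 1 -> a + b + c = P ->
  a 0 0 ^+ 2 + 2%:R * a 0 0 * b 0 0 = 1 - 2%:R * c 0 0.
Proof.
move=> aa bb cc abc.
have abE := involutions_anticommutator aa bb cc abc.
have acE : a * c + c * a = P - P * b - b * P - 1.
  by apply: involutions_anticommutator => //; rewrite addrAC.
have : a * (a * b + b * a) * a = a * b + b * a.
  by rewrite mulrDr mulrDl !mulrA aa mul1r -!mulrA aa mulr1 addrC.
rewrite abE => /(congr1 (fun A : 'M[F]_m.+1 => A 0 0)).
have -> : a * (P - P * c - c * P - 1) * a = a * P * a - a * P * (c * a) - a * c * P * a - a * a.
  by mxexp; rewrite !mulrA.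
have := congr1 (fun A : 'M[F]_m.+1 => A 0 0) acE.
rewrite /= aa !(add00, opp00) !mulAPB00 !mulPE !mulAPE eqxx /= !mulr1 !mul1r one00 P00.
move: ((c * a) 0 0) ((a * c) 0 0) (a 0 0) (b 0 0) (c 0 0) => u v x y z h1 h2.
have uE : u = 1 - y - y - 1 - v by rewrite -h1; ring.
transitivity ((x * x - x * u - v * x - 1) + 1); first by rewrite uE; ring.
by rewrite h2; ring.
Qed.

(** Subtracting two corner relations gives [2 (x - 1) (y - z) = 0] for the corners, and likewise
    with [x] and [y] exchanged. If the corners are all equal, their sum 1 forces the value 2,
    because [3 * 2 = 1]. *)
Lemma involutions_corner_cases (a b c : 'M[F]_m.+1) :
    a * a = 1 -> b * b = 1 -> c * c = 1 -> a + b + c = P ->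
  [\/ a 0 0 = 1, b 0 0 = 1, c 0 0 = 1 |
      [/\ a 0 0 = 2%:R, b 0 0 = 2%:R & c 0 0 = 2%:R]].
Proof.
move=> aa bb cc abc.
have abE := involutions_corner_rel aa bb cc abc.
have acE : a 0 0 ^+ 2 + 2%:R * a 0 0 * c 0 0 = 1 - 2%:R * b 0 0.
  by apply: involutions_corner_rel => //; rewrite addrAC.
have baE : b 0 0 ^+ 2 + 2%:R * b 0 0 * a 0 0 = 1 - 2%:R * c 0 0.
  by apply: involutions_corner_rel => //; rewrite [b + a]addrC.
have bcE : b 0 0 ^+ 2 + 2%:R * b 0 0 * c 0 0 = 1 - 2%:R * a 0 0.
  by apply: involutions_corner_rel => //; rewrite addrC addrA.
have sumE : a 0 0 + b 0 0 + c 0 0 = 1 by rewrite -!add00 abc P00.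
move: (a 0 0) (b 0 0) (c 0 0) abE acE baE bcE sumE => x y z xy xz yx yz sumE.
have x1 : (2%:R * (x - 1)) * (y - z) = 0.
  transitivity ((x ^+ 2 + 2%:R * x * y) - (x ^+ 2 + 2%:R * x * z) - 2%:R * y + 2%:R * z).
    by ring.
  by rewrite xy xz; ring.
have y1 : (2%:R * (y - 1)) * (x - z) = 0.
  transitivity ((y ^+ 2 + 2%:R * y * x) - (y ^+ 2 + 2%:R * y * z) - 2%:R * x + 2%:R * z).
    by ring.
  by rewrite yx yz; ring.
move/eqP: x1; rewrite mulf_eq0 mulf_eq0 (negPf neq0_2) /= subr_eq0.
move=> /orP[/eqP|]; first by constructor 1.
rewrite subr_eq0 => /eqP yEz.
move/eqP: y1; rewrite mulf_eq0 mulf_eq0 (negPf neq0_2) /= subr_eq0.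
move=> /orP[/eqP|]; first by constructor 2.
rewrite subr_eq0 => /eqP xEz; subst x y; constructor 4.
suff -> : z = 2%:R by [].
apply: (mulfI neq0_3); transitivity (1 : F); first by rewrite -[RHS]sumE; ring.
by rewrite -[LHS]addr0 -char5; ring.
Qed.

(** It is enough to invert [(a - b)^2], which the anticommutator formula expresses through [P] and
    [c] alone; [t (t + 1)] is the only denominator needed. *)
Lemma involutions_diff_unitmx (a b c : 'M[F]_m.+1) :
    a * a = 1 -> b * b = 1 -> c * c = 1 -> a + b + c = P ->
    c 0 0 * (c 0 0 + 1) != 0 ->
  a - b \in unitmx.
Proof.
move=> aa bb cc abc nz.
set t := c 0 0 in nz.
have yy : (a - b) * (a - b) = 3%:R *: (1 : 'M[F]_m.+1) - P + P * c + c * P.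
  transitivity (a * a + b * b - (a * b + b * a)); first by mxexp; mxlin.
  by rewrite (involutions_anticommutator aa bb cc abc) aa bb; mxlin.
pose g := (t * (t + 1))^-1; pose be := - g * (3%:R + t); pose al := g * (3%:R + t) ^+ 2 - 1.
(* The inverse of 3 - P + P c + c P is sought in the span of 1, P, P c, c P and c P c,
   which is stable under products since P c P = t P. *)
pose w := (1 : 'M[F]_m.+1) + al *: P + be *: (P * c) + be *: (c * P) + g *: (c * (P * c)).
have PPX X : P * (P * X) = P * X by rewrite mulrA PP.
have ccX X : c * (c * X) = X by rewrite mulrA cc mul1r.
have PcPX X : P * (c * (P * X)) = t *: (P * X) by rewrite 2!mulrA -[P * c * P]mulrA PAP scalerAl.
have yw : (a - b) * (a - b) * w = 3%:R *: (1 : 'M[F]_m.+1).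
  rewrite yy /w !(mulrDl, mulrDr, mulNr, mulrN, mulr1, mul1r) -!(scalerAl, scalerAr) !mul1r.
  rewrite -!mulrA ?(PP, PPX, cc, ccX, PAP, PcPX, mulr1).
  rewrite -!scalerAr -/t.
  have gE : g * (t * (t + 1)) = 1 by rewrite mulVf.
  (* The first two equations determine [be] and [al] from [g]; the other two hold by the choice of
     [g] and [5 = 0]. *)
  have cPc0 : 3%:R * g + be + g * t = 0 by rewrite /be; ring.
  have cP0 : 3%:R * be + 1 + al + be * t = 0 by rewrite /al /be; ring.
  have Pc0 : 3%:R * be - be - g * t + 1 + be * t + g = 0.
    transitivity (1 - g * (t * (t + 1)) - 5%:R * (g * (t + 1))); first by rewrite /be; ring.
    by rewrite gE char5; ring.
  have P0 : 3%:R * al - 1 - al - be * t + al * t + be = 0.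
    transitivity ((3%:R + t) * (g * (t * (t + 1)) - 1 + 5%:R * (g * (t + 1)))).
      by rewrite /al /be; ring.
    by rewrite gE char5; ring.
  transitivity (3%:R *: (1 : 'M[F]_m.+1)
     + (3%:R * al - 1 - al - be * t + al * t + be) *: P
     + (3%:R * be - be - g * t + 1 + be * t + g) *: (P * c)
     + (3%:R * be + 1 + al + be * t) *: (c * P)
     + (3%:R * g + be + g * t) *: (c * (P * c))); last first.
    by rewrite P0 Pc0 cP0 cPc0 !scale0r !addr0.
  clearbody t be al g; move: (c * (P * c)) (c * P) (P * c) P => X Y Z T.
  by apply/matrixP => i j; rewrite !mxE; ring.
have := congr1 determinant yw; rewrite detZ det1 mulr1 2!det_mulmx => dE.
rewrite unitmxE unitfE; have := expf_neq0 m.+1 neq0_3; apply: contraNneq => y0.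
by rewrite -dE y0 !mul0r.
Qed.

(** Since [a - b] anticommutes with [a + b = P - c], conjugating by it shows that [P - c] and its
    opposite have the same trace. *)
Lemma involutions_trace (a b c : 'M[F]_m.+1) :
    a * a = 1 -> b * b = 1 -> c * c = 1 -> a + b + c = P ->
  a - b \in unitmx -> \tr c = 1.
Proof.
move=> aa bb cc abc yU.
have xy : (P - c) * (a - b) = - ((a - b) * (P - c)).
  by rewrite -abc addrK; mxexp; rewrite aa bb; mxlin.
have : \tr (P - c) = - \tr (P - c).
  rewrite -{1}(mulmxK yU (P - c)) [X in X *m _]xy mulNmx linearN /=.
  by rewrite mxtrace_mulC (mulKmx yU).
move/eqP; rewrite -addr_eq0 -mulr2n -mulr_natl mulf_eq0 (negPf neq0_2) /=.
rewrite linearB /= subr_eq0 => /eqP <-.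
by rewrite /mxtrace (bigD1 0) //= big1 ?addr0 => [|i /negPf i0]; rewrite mxE ?i0.
Qed.

Lemma det_1DmulP (B : 'M[F]_m.+1) : \det (1 + B * P) = 1 + B 0 0.
Proof.
rewrite det_trig; last first.
  apply/is_trig_mxP => i j ij; rewrite mxE mulAPE mxE -val_eqE (ltn_eqF ij).
  by rewrite -val_eqE /= gtn_eqF ?mulr0 ?addr0 //; apply: leq_trans ij.
rewrite (bigD1 0) //= big1 => [|i /negPf i0]; rewrite mxE mulAPE mxE eqxx ?mulr1 //.
by rewrite i0 mulr0 addr0.
Qed.

(** The anticommutation makes [2 + c - P] and [2 - c + P] conjugate under [a - b]. Their
    determinants are computed by splitting off factors [1 + B P], and equality turns into
    [16 = 4]. *)
Lemma involutions_corner_neq1 (a b c : 'M[F]_m.+1) :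
    a * a = 1 -> b * b = 1 -> c * c = 1 -> a + b + c = P -> odd m ->
  c 0 0 != 1.
Proof.
move=> aa bb cc abc odd_m; apply/eqP => c1.
have yU : a - b \in unitmx.
  by apply: (involutions_diff_unitmx aa bb cc abc); rewrite c1 mul1r -[1 + 1]/(2%:R).
pose I2 : 'M[F]_m.+1 := 1 *+ 2.
(* Here [(2 + c) (1 + 2 c) = 4 + 5 c = -1], and below [(2 - c) (-1 + 2 c) = 1]. *)
have c2P : I2 + c - P = (I2 + c) * (1 + (1 + c *+ 2) * P).
  rewrite /I2; mxexp; rewrite !mulrA cc mul1r.
  transitivity (I2 + c - P + (P + c * P) *+ 5); first by rewrite mulr5n addr0.
  by rewrite /I2; mxlin.
have c2P' : I2 - c + P = (I2 - c) * (1 + (- 1 + c *+ 2) * P).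
  rewrite /I2; mxexp; rewrite !mulrA cc mul1r.
  transitivity (I2 - c + P + (- P + c * P) *+ 5); first by rewrite mulr5n addr0.
  by rewrite /I2; mxlin.
have comm_y : (a - b) * (I2 + c - P) = (I2 - c + P) * (a - b).
  by rewrite -abc /I2; mxexp; rewrite aa bb; mxlin.
have det_eq : \det (I2 + c - P) = \det (I2 - c + P).
  have := congr1 determinant comm_y; rewrite !det_mulmx mulrC.
  by apply: mulIf; rewrite -unitfE -unitmxE.
have c2E : I2 + c = 3%:R *: (c * (I2 - c)).
  rewrite scaler_nat /I2; mxexp; rewrite cc.
  transitivity (1 *+ 2 + c + (c - 1) *+ 5); first by rewrite mulr5n addr0.
  by mxlin.
have det2 : \det (I2 - c) != 0.
  have : \det ((I2 - c) * (I2 + c)) != 0.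
    have -> : (I2 - c) * (I2 + c) = 3%:R *: (1 : 'M[F]_m.+1).
      by rewrite scaler_nat /I2; mxexp; rewrite cc; mxlin.
    by rewrite detZ det1 mulr1 expf_neq0.
  by rewrite det_mulmx; apply: contraNneq => ->; rewrite mul0r.
move: det_eq; rewrite c2P c2P' !det_mulmx !det_1DmulP c2E detZ det_mulmx.
rewrite !(add00, opp00, one00) c1.
move: (\det (I2 - c)) det2 => d d0 dE.
have cE : \det c * \det c = 1 by rewrite -det_mulmx [c *m c]cc det1.
have h : 3%:R ^+ m.+1 * \det c * 4%:R = 2%:R.
  by apply: (mulIf d0); transitivity (d * (1 + (-1 + (1 + 1)))); [rewrite -dE | ]; ring.
(* As [9 = -1] and [m.+1] is even, squaring [h] removes both the power of 3 and the determinant of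
   [c]. *)
have three : 3%:R ^+ m.+1 * 3%:R ^+ m.+1 = 1 :> F.
  rewrite -exprMn (_ : 3%:R * 3%:R = -1); last first.
    by rewrite -[RHS]addr0 -(mul0r 2%:R) -char5; ring.
  by rewrite -signr_odd /= odd_m.
have : (3%:R ^+ m.+1 * \det c * 4%:R) ^+ 2 = 2%:R ^+ 2 by rewrite h.
have -> : (3%:R ^+ m.+1 * \det c * 4%:R) ^+ 2
    = (3%:R ^+ m.+1 * 3%:R ^+ m.+1) * (\det c * \det c) * 16%:R by ring.
rewrite three cE !mul1r => h16; case/eqP: neq0_2.
transitivity (16%:R - 2%:R ^+ 2 - 5%:R * 2%:R : F); first by ring.
by rewrite h16 char5; ring.
Qed.

(** The matrix [4 + 3 P] is chosen so that the involutions [2 G - 1] have sum [2 (4 + 3 P) - 3 = P].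
    The [E]'s only serve to make the size even. If all three corners are 2, all three traces are 1
    and [3 = 1]. *)
Lemma sum3_idempotents_not_char5 (E1 E2 E3 G1 G2 G3 : 'M[F]_m.+1) :
    E1 * E1 = E1 -> E2 * E2 = E2 -> E3 * E3 = E3 -> E1 + E2 + E3 = 4%:R ->
    G1 * G1 = G1 -> G2 * G2 = G2 -> G3 * G3 = G3 ->
  G1 + G2 + G3 != 4%:R + P *+ 3.
Proof.
move=> e1 e2 e3 sE g1 g2 g3; apply/eqP => sG.
have odd_m : odd m by have := sum3_scalar4_even e1 e2 e3 sE; rewrite /= negbK.
have invol G : G * G = G -> (G *+ 2 - 1) * (G *+ 2 - 1) = 1 :> 'M[F]_m.+1.
  by move=> GG; mxexp; rewrite GG; mxlin.
move: (invol _ g1) (invol _ g2) (invol _ g3).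
have : (G1 *+ 2 - 1) + (G2 *+ 2 - 1) + (G3 *+ 2 - 1) = P.
  transitivity ((G1 + G2 + G3) *+ 2 - 1 *+ 3); first by mxlin.
  rewrite sG; transitivity (P + (1 + P) *+ 5); first by mxlin.
  by rewrite mulr5n addr0.
move: (_ - 1) (_ - 1) (_ - 1) => c b a abc aa bb cc.
have bca : b + c + a = P by rewrite addrC addrA abc.
have cab : c + a + b = P by rewrite -addrA addrC abc.
case: (involutions_corner_cases aa bb cc abc) => [/eqP|/eqP|/eqP|[a2 b2 c2]].
- by rewrite (negPf (involutions_corner_neq1 bb cc aa bca odd_m)).
- by rewrite (negPf (involutions_corner_neq1 cc aa bb cab odd_m)).
- by rewrite (negPf (involutions_corner_neq1 aa bb cc abc odd_m)).
have nz2 (x : F) : x = 2%:R -> x * (x + 1) != 0.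
  by move=> ->; rewrite mulf_neq0 // -[_ + 1]/(1 + 1 + 1) -addrA -[1 + _]/(3%:R).
have ta := involutions_trace bb cc aa bca (involutions_diff_unitmx bb cc aa bca (nz2 _ a2)).
have tb := involutions_trace cc aa bb cab (involutions_diff_unitmx cc aa bb cab (nz2 _ b2)).
have tc := involutions_trace aa bb cc abc (involutions_diff_unitmx aa bb cc abc (nz2 _ c2)).
have tP : \tr P = 1.
  by rewrite /mxtrace (bigD1 0) //= big1 ?addr0 => [|i /negPf i0]; rewrite mxE ?i0.
move: tP; rewrite -abc !linearD /= ta tb tc => /eqP.
by rewrite -subr_eq0 addrK (negPf neq0_2).
Qed.

End CharFive.

(** * Rings whose matrices are sums of three idempotents *)

Definition sum3_idempotents (R : pzRingType) n := forall A : 'M[R]_n,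
  exists E1 E2 E3 : 'M[R]_n,
    [/\ idempotent_elt E1, idempotent_elt E2, idempotent_elt E3 & A = E1 + E2 + E3].

Lemma idempotent_mulr (R : pzRingType) (e : R) : idempotent_elt e -> e * e = e.
Proof. by rewrite /idempotent_elt expr2. Qed.

(* Automatic for prime ideals; for I = 0 it says that R has no nontrivial idempotent. *)
Definition idempotent_dichotomy (R : pzRingType) (I : set R) :=
  forall e : R, e * e = e -> I e \/ I (1 - e).

(** The trace is the sum of the [i * f_i]. If some [f_k] is 1 modulo [I], orthogonality puts the
    other [f_i] in [I] and the trace is [k]; otherwise all [f_i] lie in [I]. *)
Lemma trace_idempotent_mod (R : comNzRingType) n (E : 'M[R]_n) (I : set R) :
    left_ideal I -> idempotent_dichotomy I -> E *m E = E ->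
  exists k : nat, I (\tr E - k%:R).
Proof.
move=> Ii Iidem EE; have [f [ff f1 <-]] := idempotent_trace EE.
have [I0 ID IM] := Ii.
have -> : f^`().[1] = \sum_(i < size f) i%:R * f`_i.
  rewrite -[f in LHS]coefK poly_def linear_sum horner_sum; apply: eq_bigr => i _.
  by rewrite linearZ /= derivXn hornerZ hornerMn hornerXn expr1n mulrC.
have {}f1 : \sum_(i < size f) f`_i = 1.
  by rewrite -f1 horner_coef; apply: eq_bigr => i _; rewrite expr1n mulr1.
have [[k Ik]|noI] := pselect (exists k : 'I_(size f), I (1 - f`_k)).
  exists k; rewrite -[k%:R]mulr1 -f1 mulr_sumr -sumrB; apply: left_ideal_sum => // i _.
  rewrite -mulrBl; have [->|ik] := eqVneq i k; first by rewrite subrr mul0r.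
  have -> : f`_i = f`_i * (1 - f`_k); last exact: IM _ _ (IM _ _ Ik).
  by rewrite mulrBr mulr1 ff [X in if X then _ else _](negbTE ik) subr0.
exists 0%N; rewrite subr0; apply: left_ideal_sum => // i _; apply: IM.
have [//|I1] : I f`_i \/ I (1 - f`_i) by apply: Iidem; rewrite ff eqxx.
by case: noI; exists i.
Qed.

Lemma sum3_nat_mod (R : comPzRingType) m (I : set R) :
    sum3_idempotents R m.+1 -> left_ideal I -> idempotent_dichotomy I ->
  forall x : R, exists k : nat, I (x - k%:R).
Proof.
move=> sum3 Ii Iidem x.
have [R0|nz] := eqVneq (1 : R) 0.
  by exists 0%N; rewrite -[_ - _]mulr1 R0 mulr0; case: Ii.
pose R' : comNzRingType := HB.pack R (GRing.PzSemiRing_isNonZero.Build R nz).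
have trE (E : 'M[R]_m.+1) : idempotent_elt E -> exists k : nat, I (\tr E - k%:R).
  by move=> /idempotent_mulr EE; apply: (@trace_idempotent_mod R' m.+1 E I).
(* A matrix of trace [x]. *)
have [E1 [E2 [E3 [/trE[k1 Ik1] /trE[k2 Ik2] /trE[k3 Ik3] defx]]]] := sum3 (x *: delta_mx 0 0).
exists (k1 + k2 + k3)%N.
have -> : x = \tr E1 + \tr E2 + \tr E3.
  rewrite -!mxtraceD -defx mxtraceZ /mxtrace (bigD1 0) //= big1 => [|i /negPf i0].
    by rewrite mxE eqxx addr0 mulr1.
  by rewrite mxE i0.
have -> : \tr E1 + \tr E2 + \tr E3 - (k1 + k2 + k3)%:R
    = (\tr E1 - k1%:R) + (\tr E2 - k2%:R) + (\tr E3 - k3%:R) by rewrite !natrD; ring.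
by have [_ ID _] := Ii; apply: (ID _ _ (ID _ _ Ik1 Ik2) Ik3).
Qed.

(** The map sends [x] to any natural number congruent to it modulo [I]. This is well defined: by
    Bezout, a natural number in [I] prime to [p] would put 1 in [I]. *)
Lemma residue_field_Fp (R : comPzRingType) (p : nat) (I : set R) :
    prime p -> left_ideal I -> ~ I 1 -> I p%:R ->
    (forall x, exists k : nat, I (x - k%:R)) ->
  exists f : {rmorphism R -> 'F_p}, forall x, f x = 0 <-> I x.
Proof.
move=> pr_p Ii I1 Ip resid; have [I0 ID IM] := Ii.
have IB x y : I x -> I y -> I (x - y) by apply: left_ideal_sub.
have Inat (d : nat) : I d%:R -> d%:R = 0 :> 'F_p.
  move=> Id; apply/eqP; rewrite -(dvdn_pcharf (pchar_Fp pr_p)).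
  apply: contrapT => ndvd; apply: I1.
  have cop : coprime p d by rewrite prime_coprime //; apply/negP.
  have [/= u _ ] := Bezoutl d (prime_gt0 pr_p).
  rewrite (eqP cop) => /dvdnP[v /(congr1 (fun k => k%:R : R))].
  rewrite natrD !natrM => e.
  have -> : 1 = v%:R * p%:R - u%:R * d%:R :> R by rewrite -e addrK.
  by apply: IB; apply: IM.
pose f (x : R) : 'F_p := (projT1 (cid (resid x)))%:R.
have fE x (k : nat) : I (x - k%:R) -> f x = k%:R.
  rewrite /f; case: cid => l /= xl xk.
  have Ilk : I (l%:R - k%:R).
    have -> : l%:R - k%:R = (x - k%:R) - (x - l%:R) :> R by ring.
    exact: IB.
  have [lk|/ltnW kl] := leqP l k.
    have /Inat : I (k - l)%:R.
      by rewrite natrB // -opprB -[- _]mulN1r; apply: IM.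
    by rewrite natrB // => /eqP; rewrite subr_eq0 => /eqP.
  have /Inat : I (l - k)%:R by rewrite natrB.
  by rewrite natrB // => /eqP; rewrite subr_eq0 => /eqP.
have fD x y : f (x + y) = f x + f y.
  have [k xk] := resid x; have [l yl] := resid y.
  rewrite (fE x k) // (fE y l) // -natrD; apply: fE.
  by have := ID _ _ xk yl; congr (I _); rewrite natrD; ring.
have fM x y : f (x * y) = f x * f y.
  have [k xk] := resid x; have [l yl] := resid y.
  rewrite (fE x k) // (fE y l) // -natrM; apply: fE.
  have := ID _ _ (IM y _ xk) (IM k%:R _ yl); congr (I _); rewrite natrM; ring.
have f1 : f 1 = 1 by rewrite (fE 1 1%N) // subrr.
have fB : zmod_morphism f.
  by move=> x y; apply: (addIr (f y)); rewrite -fD !subrK.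
pose fA := GRing.isZmodMorphism.Build _ _ f fB.
pose fR := GRing.isMonoidMorphism.Build _ _ f (conj f1 fM).
pose g : {rmorphism R -> 'F_p} := HB.pack f fA fR.
exists g => x; have [k xk] := resid x; rewrite [g x](fE x k) //; split.
  move/eqP; rewrite -(dvdn_pcharf (pchar_Fp pr_p)) => /dvdnP[q kE].
  by rewrite -[x](subrK k%:R) {2}kE natrM; apply: ID => //; apply: IM.
by move=> Ix; apply: Inat; rewrite -[k%:R](subKr x); apply: IB.
Qed.

Lemma prime_ideal_dichotomy (R : comPzRingType) (P : set R) :
  P 0 -> (forall a b, P (a * b) -> P a \/ P b) -> idempotent_dichotomy P.
Proof. by move=> P0 prP e ee; apply: prP; rewrite mulrBr mulr1 ee subrr. Qed.

(** Otherwise 5 lies in a maximal ideal with residue field ['F_5], and the decompositions of [4] and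
    [4 + 3 P] reduce to an excluded configuration. *)
Lemma sum3_5_unit (R : comPzRingType) m :
  sum3_idempotents R m.+1 -> exists b : R, b * 5%:R = 1.
Proof.
move=> sum3; have [//|[M maxM M5]] := unit_or_maximal (5%:R : R).
have [Mi M1 _] := maxM; have [P0 _ _] := Mi.
have prM : forall a b, M (a * b) -> M a \/ M b.
  by move/maximal_left_idealP: maxM => [? ? ?]; apply: ideal_avoiding_powers_prime.
have resid := sum3_nat_mod sum3 Mi (prime_ideal_dichotomy P0 prM).
have [f _] := @residue_field_Fp _ 5 _ isT Mi M1 M5 resid.
have char5 : 5%:R = 0 :> 'F_5 by rewrite pchar_Fp_0.
have mapidem (E : 'M[R]_m.+1) : idempotent_elt E -> map_mx f E * map_mx f E = map_mx f E.
  by move=> /idempotent_mulr EE; rewrite -[LHS]map_mxM [E *m E]EE.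
have [E1 [E2 [E3 [/mapidem e1 /mapidem e2 /mapidem e3 sE]]]] := sum3 4%:R.
have [G1 [G2 [G3 [/mapidem g1 /mapidem g2 /mapidem g3 sG]]]] := sum3 (4%:R + delta_mx 0 0 *+ 3).
have sE' : map_mx f E1 + map_mx f E2 + map_mx f E3 = 4%:R.
  by rewrite -!map_mxD -sE; exact: (rmorph_nat (map_mx f)).
have := sum3_idempotents_not_char5 char5 e1 e2 e3 sE' g1 g2 g3.
case/eqP; rewrite -!map_mxD -sG map_mxD; congr (_ + _).
  exact: (rmorph_nat (map_mx f)).
by rewrite raddfMn /= map_delta_mx.
Qed.

Lemma sum3_mul60 (R : comPzRingType) n (E1 E2 E3 : 'M[R]_n) :
    idempotent_elt E1 -> idempotent_elt E2 -> idempotent_elt E3 -> 4%:R = E1 + E2 + E3 ->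
  [/\ E1 *+ 60 = 0, E2 *+ 60 = 0 & E3 *+ 60 = 0].
Proof.
move=> /idempotent_mulr e1 /idempotent_mulr e2 /idempotent_mulr e3 sE; split.
- exact: (mul60_idempotent e1 e2 e3).
- by apply: (mul60_idempotent e2 e1 e3); rewrite sE [E2 + E1]addrC.
- by apply: (mul60_idempotent e3 e1 e2); rewrite sE -addrA addrC.
Qed.

(** Adding the three relations gives [240 = 5 * 48 = 0], and 5 is invertible. *)
Lemma sum3_48_eq0 (R : comPzRingType) m : sum3_idempotents R m.+1 -> 48%:R = 0 :> R.
Proof.
move=> sum3; have [b b5] := sum3_5_unit sum3.
have [E1 [E2 [E3 [e1 e2 e3 sE]]]] := sum3 4%:R.
have [z1 z2 z3] := sum3_mul60 e1 e2 e3 sE.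
have : (4%:R : 'M[R]_m.+1) *+ 60 = 0 by rewrite sE !mulrnDl z1 z2 z3 !addr0.
move=> /matrixP/(_ 0 0); rewrite -mulrnA mulmxnE !mxE => h.
by rewrite -[48%:R]mul1r -{1}b5 -mulrA -natrM [_%:R]h mulr0.
Qed.

(** * The cube identity and the nilpotency of the radical *)

Lemma prime_ideal_cube (R : comPzRingType) m (P : set R) :
    sum3_idempotents R m.+1 -> left_ideal P -> (forall a b, P (a * b) -> P a \/ P b) ->
  forall x, P (x ^+ 3 - x).
Proof.
move=> sum3 Pi prP x; have [P0 PD PM] := Pi.
have P6 : P 6%:R.
  have prP' a : P (a * a) -> P a by case/prP.
  (* The fourth power of 6 is [27 * 48 = 0]. *)
  apply/prP'/prP'; rewrite -!natrM.
  by rewrite -[(_ * _)%N]/(27 * 48)%N natrM (sum3_48_eq0 sum3) mulr0.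
have [k xk] := sum3_nat_mod sum3 Pi (prime_ideal_dichotomy P0 prP) x.
(* This makes the truncated subtraction below a true one. *)
have kk3 : (k <= k ^ 3)%N by case: (k) => // k'; rewrite -{1}[k'.+1]expn1 leq_pexp2l.
have [j kj] : exists j, (k ^ 3 - k = j * 6)%N.
  apply/dvdnP; rewrite -eqn_mod_dvd //.
  rewrite -modnXm -[eqbRHS]modn_mod.
  by case: (k %% 6)%N (ltn_pmod k (isT : 0 < 6)%N) => [|[|[|[|[|[|]]]]]].
have k3 : k%:R ^+ 3 - k%:R = j%:R * 6%:R :> R.
  by rewrite -natrM -kj natrB ?natrX.
have -> : x ^+ 3 - x = (x ^+ 2 + x * k%:R + k%:R ^+ 2 - 1) * (x - k%:R) + (k%:R ^+ 3 - k%:R).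
  by ring.
by rewrite k3; apply: (PD); apply: (PM).
Qed.

Lemma sum3_cube_jquot (R : comPzRingType) m :
  sum3_idempotents R m.+1 -> cube_identity (jacobson_quot R).
Proof.
move=> sum3; elim/quotW => a.
rewrite (_ : _ ^+ 3 = \pi_(jacobson_quot R) (a ^+ 3))%qT; last first.
  by rewrite !exprS expr0 !mulr1 !jquot_piM.
apply/eqP; rewrite jquot_eqE; apply/in_jacobson => M maxM.
apply: (prime_ideal_cube sum3); first by case: maxM.
by move/maximal_left_idealP: maxM => [? ? ?]; apply: ideal_avoiding_powers_prime.
Qed.

(** A non-nilpotent [x] is missed by some prime [P], which contains [x (x^2 - 1)]. For [x] in the
    radical, [x^2 - 1] is a unit, so [P] would contain [x] or 1. *)
Lemma sum3_nil_jacobson (R : comPzRingType) m :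
  sum3_idempotents R m.+1 -> nil_jacobson R.
Proof.
move=> sum3 x xJ; apply: contrapT => xnil.
have [||P [_ Pi Px maxP]] := @exists_ideal_avoiding_powers R x [set 0]%classic.
- by split=> // [? ? -> ->|a ? ->]; rewrite ?addr0 ?mulr0.
(* Exponent 0 would mean [1 = 0], and then already [x = 0]. *)
- move=> [|k] xk0; apply: xnil; last by exists k.
  by exists 0%N; rewrite expr1 -[x]mulr1 -(expr0 x) xk0 mulr0.
have prP := ideal_avoiding_powers_prime Pi Px maxP.
have [P0 PD PM] := Pi.
have [b bE] : exists b, b * (x ^+ 2 - 1) = 1.
  have [//|[M maxM Mx]] := unit_or_maximal (x ^+ 2 - 1).
  have [Mi M1 _] := maxM; case: M1.
  have -> : 1 = x * x - (x ^+ 2 - 1) by ring.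
  by apply: left_ideal_sub => //; case: Mi => _ _; apply; move/in_jacobson: xJ; apply.
have := prime_ideal_cube sum3 Pi prP x.
have -> : x ^+ 3 - x = x * (x ^+ 2 - 1) by ring.
case/prP => [x1|x21]; first by apply: (Px 1%N).
by apply: (Px 0%N); rewrite expr0 -bE; apply: PM.
Qed.

(** * Indecomposable rings *)

(** [A] is the corner [e R] with identity [e], realised as the elements fixed by [e]; [p] is
    multiplication by [e] and [v] the inclusion. *)
Lemma idempotent_corner (R : comPzRingType) (e : R) : e * e = e -> e <> 0 ->
  exists (A : nzRingType) (p : {rmorphism R -> A}) (v : A -> R),
    cancel v p /\ forall x, v (p x) = e * x.
Proof.
move=> ee e0; pose T := {x : R | e * x == x}.
have eT x : e * (e * x) == e * x by rewrite mulrA ee.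
pose p x : T := exist _ (e * x) (eT x).
have vT (x : T) : e * val x = val x by apply/eqP; exact: (valP x).
have pE x y : e * x = e * y -> p x = p y by move=> xy; apply: val_inj.
have pK (x : T) : p (val x) = x by apply: val_inj; rewrite /= vT.
pose add (x y : T) := p (val x + val y).
pose opp (x : T) := p (- val x).
pose mul (x y : T) := p (val x * val y).
have addA : associative add by move=> x y z; apply: pE; rewrite /= !mulrDr !vT addrA.
have addC : commutative add by move=> x y; apply: pE; rewrite addrC.
have add0 : left_id (p 0) add by move=> x; rewrite /add /= mulr0 add0r pK.
have addN : left_inverse (p 0) opp add by move=> x; apply: pE; rewrite /= mulrN vT addNr.
pose zm := GRing.isZmodule.Build T addA addC add0 addN.
pose Z : zmodType := HB.pack T zm.
have mulA : associative mul by move=> x y z; apply: pE => /=; ring.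
have mul1 : left_id (p 1) mul by move=> x; rewrite /mul /= mulr1 vT pK.
have mulr1' : right_id (p 1) mul by move=> x; rewrite /mul /= mulr1 mulrC vT pK.
have mulDl : left_distributive mul add by move=> x y z; apply: pE => /=; ring.
have mulDr : right_distributive mul add by move=> x y z; apply: pE => /=; ring.
have ne10 : p 1 != p 0 by apply/eqP => /(congr1 val) /=; rewrite mulr1 mulr0.
pose rm := GRing.Zmodule_isNzRing.Build Z mulA mul1 mulr1' mulDl mulDr ne10.
pose A : nzRingType := HB.pack Z rm.
have pB : zmod_morphism (p : R -> A).
  by move=> x y; apply: pE; rewrite /= !(mulrDr, mulrN) !mulrA !ee.
have pM : monoid_morphism (p : R -> A).
  by split=> // x y; apply: pE; rewrite /= mulrACA !mulrA !ee.
pose pA := GRing.isZmodMorphism.Build R A p pB.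
pose pR := GRing.isMonoidMorphism.Build R A p pM.
pose g : {rmorphism R -> A} := HB.pack (p : R -> A) pA pR.
by exists A, g, val.
Qed.

(** If neither [e] nor [1 - e] vanishes, the Peirce decomposition makes [R] the product of two
    nonzero corners. *)
Lemma indecomposable_idempotent (R : comPzRingType) :
  indecomposable_ring R -> idempotent_dichotomy [set (0 : R)]%classic.
Proof.
move=> [_ indec] e ee; have [|e0] := pselect (e = 0); first by left.
have [|f0] := pselect (1 - e = 0); [by right | case: indec].
have ff : (1 - e) * (1 - e) = 1 - e by rewrite mulrBl mul1r mulrBr mulr1 ee subrr subr0.
have [A [p [v [vK pE]]]] := idempotent_corner ee e0.
have [B [q [w [wK qE]]]] := idempotent_corner ff f0.
have vE a : v a = e * v a by rewrite -pE vK.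
have wE b : w b = (1 - e) * w b by rewrite -qE wK.
have p0 x : e * x = 0 -> p x = 0.
  by move=> ex; rewrite -[p x]vK pE ex -(mulr0 e) -pE vK rmorph0.
have q0 x : (1 - e) * x = 0 -> q x = 0.
  by move=> ex; rewrite -[q x]wK qE ex -(mulr0 (1 - e)) -qE wK rmorph0.
pose f x : (A * B)%type := (p x, q x).
have fB : zmod_morphism f by move=> x y; rewrite /f !rmorphB.
have fM : monoid_morphism f by split=> [|x y]; rewrite /f ?rmorph1 ?rmorphM.
pose fA := GRing.isZmodMorphism.Build _ _ f fB.
pose fR := GRing.isMonoidMorphism.Build _ _ f fM.
pose g : {rmorphism R -> (A * B)%type} := HB.pack f fA fR.
exists A, B, g; exists (fun ab => v ab.1 + w ab.2) => [x|[a b]] /=.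
  by rewrite pE qE mulrBl mul1r addrC subrK.
rewrite /f !rmorphD !vK !wK p0 ?q0 ?addr0 ?add0r //.
  by rewrite vE mulrA mulrBl mul1r ee subrr mul0r.
by rewrite wE mulrA mulrBr mulr1 ee subrr mul0r.
Qed.

(** [R] is the image of the integers, and [k] generates the kernel. The bound [1 < k] matters:
    ['Z_0] and ['Z_1] are by convention the integers modulo 2. *)
Lemma ring_isomorphic_Zp (R : comPzRingType) (k : nat) : (1 < k)%N ->
    k%:R = 0 :> R -> (forall j, (0 < j < k)%N -> j%:R <> 0 :> R) ->
    (forall x : R, exists j : nat, x = j%:R) ->
  ring_isomorphic R 'Z_k.
Proof.
move=> k1 k0 kmin natR.
have mod_k (j : nat) : j%:R = (j %% k)%:R :> R.
  by rewrite {1}(divn_eq j k) natrD natrM k0 mulr0 add0r.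
have Zmod_k (j : nat) : j%:R = (j %% k)%:R :> 'Z_k.
  by apply: val_inj; rewrite /= !Zp_nat /= Zp_cast // modn_mod.
pose f (x : R) : 'Z_k := (projT1 (cid (natR x)))%:R.
have inj (i j : nat) : i%:R = j%:R :> R -> i%:R = j%:R :> 'Z_k.
  rewrite (mod_k i) (mod_k j) (Zmod_k i) (Zmod_k j).
  have := ltn_pmod i (ltnW k1); have := ltn_pmod j (ltnW k1).
  move: (i %% k)%N (j %% k)%N => {}i {}j jk ik ij.
  wlog le_ij : i j jk ik ij / (i <= j)%N.
    by move=> h; case/orP: (leq_total i j) => ?; [apply: h | apply/esym/h].
  have : (j - i)%:R = 0 :> R by rewrite natrB // ij subrr.
  have [-> //|lt_ij] := eqVneq i j.
  case/kmin; rewrite subn_gt0 ltn_neqAle lt_ij le_ij /=.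
  exact: leq_ltn_trans (leq_subr _ _) jk.
have fE (j : nat) : f j%:R = j%:R by apply: inj; rewrite /f; case: cid.
have fD x y : f (x + y) = f x + f y.
  by have [[i ->] [j ->]] := (natR x, natR y); rewrite -natrD !fE natrD.
have fM x y : f (x * y) = f x * f y.
  by have [[i ->] [j ->]] := (natR x, natR y); rewrite -natrM !fE natrM.
have fB : zmod_morphism f by move=> x y; apply: (addIr (f y)); rewrite -fD !subrK.
pose fA := GRing.isZmodMorphism.Build _ _ f fB.
pose fR := GRing.isMonoidMorphism.Build _ _ f (conj (fE 1) fM).
pose g : {rmorphism R -> 'Z_k} := HB.pack f fA fR.
exists g; exists (fun z : 'Z_k => (z : nat)%:R) => [x|z].
  by have [j ->] := natR x; rewrite [g _](fE j) val_Zp_nat -?mod_k.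
by rewrite [g _](fE z) natr_Zp.
Qed.

(** Once all entries are even, [E = 2 F] gives [E = 4 F^2], so [E = E * E = (4 E) F^2 = 0]. *)
Lemma even_idempotent_eq0 (R : comPzRingType) n (E : 'M[R]_n) :
    (forall x : R, exists j : nat, x = j%:R) -> 16%:R = 0 :> R -> 4%:R <> 0 :> R ->
    E * E = E -> E *+ 4 = 0 ->
  E = 0.
Proof.
move=> natR R16 R4 EE E4.
(* If a = 2 q + 1 and 4 a = 0 then 4 = - 8 q, hence 4 = 16 q^2 = 0. *)
have even_entry i j : exists q : R, E i j = q *+ 2.
  have Eij : E i j *+ 4 = 0 by rewrite -mulmxnE E4 mxE.
  have [k kE] := natR (E i j); exists (k./2)%:R.
  have := odd_double_half k; case: (odd k) => kk; last first.
    by rewrite kE -{1}kk add0n -muln2 natrM mulr_natr.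
  case: R4; move: Eij; rewrite kE -{1}kk -muln2 natrD natrM.
  move: (k./2)%:R => q q4.
  transitivity ((1%:R + q * 2%:R) *+ 4 * (1 - 2%:R * q) + 16%:R * q ^+ 2); first by ring.
  by rewrite q4 R16; ring.
pose F : 'M[R]_n := \matrix_(i, j) projT1 (cid (even_entry i j)).
have EF : E = F *+ 2 by apply/matrixP => i j; rewrite mulmxnE mxE; case: cid.
have E2 : E = (F * F) *+ 4 by rewrite -EE EF mulrnAl mulrnAr -mulrnA.
by rewrite -EE {2}E2 mulrnAr -mulrnAl E4 mul0r.
Qed.

Lemma sum3_indecomposable (R : comPzRingType) m :
    sum3_idempotents R m.+1 -> indecomposable_ring R ->
  exists2 k : nat, k \in [:: 2; 3; 4]%N & ring_isomorphic R 'Z_k.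
Proof.
move=> sum3 indec; have conn := indecomposable_idempotent indec.
have [R1 _] := indec; have R48 := sum3_48_eq0 sum3.
have natR (x : R) : exists j : nat, x = j%:R.
  have I0 : left_ideal [set (0 : R)]%classic.
    by split=> // [? ? -> ->|a ? ->]; rewrite ?addr0 ?mulr0.
  by have [k /eqP] := sum3_nat_mod sum3 I0 conn x; rewrite subr_eq0 => /eqP; exists k.
(* 16 is idempotent modulo 48, since [256 = 16 + 5 * 48]; this separates the 2-part of 48 from the
   3-part. *)
have [R16|R15] : 16%:R = 0 :> R \/ 1 - 16%:R = 0 :> R.
- by apply: conn; transitivity (16%:R + 5%:R * 48%:R : R); [ring | rewrite R48; ring].
- have R4 : 4%:R = 0 :> R.
    apply: contrapT => R4; have [E1 [E2 [E3 [e1 e2 e3 sE]]]] := sum3 4%:R.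
    have [z1 z2 z3] := sum3_mul60 e1 e2 e3 sE.
    have E0 (E : 'M[R]_m.+1) : idempotent_elt E -> E *+ 60 = 0 -> E = 0.
      move=> /idempotent_mulr EE E60; apply: even_idempotent_eq0 => //.
      (* Together with [60 E = 0] this gives [4 E = 0]. *)
      have E64 : E *+ 64 = 0.
        apply/matrixP => i j; rewrite mulmxnE -[64%N]/(16 * 4)%N mulrnA -[_ *+ 16]mulr_natr R16.
        by rewrite mulr0 mul0rn mxE.
      by move: E64; rewrite -[64%N]/(60 + 4)%N mulrnDr E60 add0r.
    move: sE; rewrite (E0 E1) // (E0 E2) // (E0 E3) // !addr0 => /matrixP/(_ 0 0).
    by rewrite mulmxnE !mxE.
  have [R2|R2] := pselect (2%:R = 0 :> R).
    exists 2%N => //; apply: ring_isomorphic_Zp => // j.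
    by case: j => [|[|j]].
  exists 4%N => //; apply: ring_isomorphic_Zp => // j.
  case: j => [|[|[|[|j]]]] // _ R3; apply: R1.
  by transitivity (4%:R - 3%:R : R); [ring | rewrite R4 R3 subrr].
have R3 : 3%:R = 0 :> R.
  by transitivity (48%:R + 3%:R * (1 - 16%:R) : R); [ring | rewrite R48 R15; ring].
exists 3%N => //; apply: ring_isomorphic_Zp => // j.
case: j => [|[|[|j]]] // _ R2; apply: R1.
by transitivity (3%:R - 2%:R : R); [ring | rewrite R3 R2 subrr].
Qed.

Theorem theorem1p2 (R : comPzRingType) (n : nat) (n_ge1 : (1 <= n)%N)
  (sum3 : forall A : 'M[R]_n, exists E1 E2 E3 : 'M[R]_n,
     [/\ idempotent_elt E1, idempotent_elt E2, idempotent_elt E3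
       & A = E1 + E2 + E3]) :
  [/\ nil_jacobson R,
      cube_identity (jacobson_quot R)
    & indecomposable_ring R ->
      exists2 k : nat, k \in [:: 2; 3; 4]%N & ring_isomorphic R 'Z_k].
Proof.
case: n n_ge1 sum3 => // m _ sum3; split.
- exact: sum3_nil_jacobson sum3.
- exact: sum3_cube_jquot sum3.
- exact: sum3_indecomposable sum3.
Qed.
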